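(* For any integer $n\ge 0$, we have \[\mathrm{pod}_{-3}(7n+3)\equiv (-1)^{n+1}r_3(8n+3) \pmod{7}.\]
   Context: $\mathrm{pod}_{-3}(n)$ denotes the number of partition triples of $n$ in which the odd parts in each of the three partitions are distinct. Equivalently, as formal power series, \[\sum_{n=0}^{\infty}\mathrm{pod}_{-3}(n)q^n=\frac{(-q;q^2)_\infty^3}{(q^2;q^2)_\infty^3}=\frac{1}{\psi(-q)^3},\] where $\psi(q)=\sum_{n=0}^{\infty}q^{n(n+1)/2}$ and $(a;q)_\infty=\prod_{k\ge 0}(1-aq^k)$. $r_k(n)$ denotes the number of representations of $n$ as a sum of $k$ squares, i.e. the number of $(x_1,\dots,x_k)\in\mathbb{Z}^k$ with $x_1^2+\cdots+x_k^2=n$. *)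

(* Defs.v *)
From HB Require Import structures.
From mathcomp Require Import all_boot all_order all_algebra.

Set Implicit Arguments.
Unset Strict Implicit.
Unset Printing Implicit Defensive.

Import Order.TTheory GRing.Theory Num.Theory.

Local Open Scope nat_scope.

(* A partition is the weakly decreasing sequence of its positive parts; its
   even parts may be repeated, its odd parts may not. *)
Definition is_pod_partition (s : seq nat) : bool :=
  [&& sorted geq s, 0 \notin s & uniq [seq i <- s | odd i]].

Definition is_pod_triple (n : nat) (t : seq nat * seq nat * seq nat) : bool :=
  [&& is_pod_partition t.1.1, is_pod_partition t.1.2, is_pod_partition t.2
    & sumn t.1.1 + sumn t.1.2 + sumn t.2 == n].

(* In a partition triple of n every partition has at most n parts, each of
   them at most n, so it is an element of the finite type of sequences of
   length at most n over {0, ..., n}; see pod3P. *)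
Definition bpart (n : nat) : finType := n.-bseq 'I_n.+1.

Definition parts n (s : bpart n) : seq nat := [seq val i | i <- bseqval s].

Definition triple_parts n (t : bpart n * bpart n * bpart n) :=
  (parts t.1.1, parts t.1.2, parts t.2).

Definition pod3 (n : nat) : nat :=
  #|[set t : bpart n * bpart n * bpart n | is_pod_triple n (triple_parts t)]|.

(* Coordinates of a representation of n lie in {-n, ..., n}; they are encoded
   as j - n with 0 <= j <= 2n; see nb_sum_squaresP. *)
Definition shift_coord k n (x : {ffun 'I_k -> 'I_(n.*2).+1}) :
    {ffun 'I_k -> int} :=
  [ffun i => ((x i : nat)%:Z - n%:Z)%R].

Definition nb_sum_squares (k n : nat) : nat :=
  #|[set x : {ffun 'I_k -> 'I_(n.*2).+1} |
      (\sum_i shift_coord x i ^+ 2 == n%:Z)%R]|.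

Lemma card_set_size (T : finType) (U : eqType) (f : T -> U) (P : pred U)
    (s : seq U) :
  injective f -> (forall u, P u -> exists t, f t = u) ->
  uniq s -> (forall u, (u \in s) = P u) -> #|[set t | P (f t)]| = size s.
Proof.
move=> f_inj f_onto s_uniq sP.
rewrite cardE -(size_map f); apply/perm_size/uniq_perm => //.
  by rewrite map_inj_uniq // enum_uniq.
move=> u; rewrite sP; apply/mapP/idP => [[t]|Pu].
  by rewrite mem_enum inE => Pft ->.
by have [t ft] := f_onto u Pu; exists t; rewrite // mem_enum inE ft.
Qed.

Lemma parts_inj n : injective (@parts n).
Proof. by move=> s t /(inj_map val_inj) /val_inj. Qed.

Lemma parts_onto n s : is_pod_partition s -> sumn s <= n ->
  exists t : bpart n, parts t = s.
Proof.
move=> /and3P[_ s0 _] s_le.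
have size_s : size s <= n.
  apply: leq_trans s_le; elim: s s0 => //= a s IH.
  rewrite inE negb_or eq_sym -lt0n => /andP[a0 /IH].
  by rewrite -add1n; apply: leq_add.
have le_s i : i \in s -> i <= n.
  move=> si; apply: leq_trans s_le; elim: s si {s0 size_s} => //= a s IH.
  rewrite inE => /orP[/eqP->|/IH/leq_trans-> //]; [exact: leq_addr|exact: leq_addl].
have size_t : size [seq inord i : 'I_n.+1 | i <- s] <= n by rewrite size_map.
exists (Bseq size_t); rewrite /parts /= -map_comp -[RHS]map_id.
by apply/eq_in_map => i /le_s i_le /=; rewrite inordK.
Qed.

Lemma pod3P n (s : seq (seq nat * seq nat * seq nat)) :
  uniq s -> (forall t, (t \in s) = is_pod_triple n t) -> pod3 n = size s.
Proof.
apply: card_set_size => [[[a b] c] [[a' b'] c'] []|[[a b] c]].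
  by move=> /parts_inj-> /parts_inj-> /parts_inj->.
move=> /and4P[/= pa pb pc /eqP n_eq].
have [||a' <-] := @parts_onto n a => //.
  by rewrite -n_eq -addnA leq_addr.
have [||b' <-] := @parts_onto n b => //.
  by rewrite -n_eq addnAC leq_addl.
have [||c' <-] := @parts_onto n c => //.
  by rewrite -n_eq leq_addl.
by exists (a', b', c').
Qed.

Lemma nb_sum_squaresP k n (s : seq {ffun 'I_k -> int}) :
  uniq s -> (forall x, (x \in s) = (\sum_i x i ^+ 2 == n%:Z)%R) ->
  nb_sum_squares k n = size s.
Proof.
pose P (x : {ffun 'I_k -> int}) := (\sum_i x i ^+ 2 == n%:Z)%R.
apply: (@card_set_size _ _ _ P) => [x y /ffunP xy|x /eqP xn].
  apply/ffunP => i; have := xy i; rewrite !ffunE => /addIr [].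
  exact: val_inj.
have x_le i : (`|x i| <= n%:Z)%R.
  apply: (@le_trans _ _ (x i ^+ 2)%R); last first.
    rewrite -xn (bigD1 i) //= lerDl; apply: sumr_ge0 => j _; exact: sqr_ge0.
  rewrite -real_normK ?num_real //; case: (`|x i|%R =P 0%R) => [->//|/eqP nz].
  by rewrite expr2 ler_peMr // -gtz0_ge1 lt_def nz /=.
exists [ffun i => inord `|(x i + Posz n)%R|].
apply/ffunP => i; rewrite !ffunE.
have := x_le i; rewrite ler_norml => /andP[lo hi].
have ge0 : (0 <= x i + n%:Z)%R by rewrite addrC -lerBlDl sub0r.
rewrite inordK; first by rewrite gez0_abs // addrK.
by rewrite ltnS -lez_nat gez0_abs // -addnn PoszD lerD2r.
Qed.

(* Main.v *)
(* Put P = 1/ψ(-X)^3, the generating function of pod_{-3}. Modulo 7 we have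
   P = ψ(-X)^4 / ψ(-X)^7 = ψ(-X)^4 / ψ(-X^7), so extracting the exponents
   congruent to 3 modulo 7 only affects ψ(-X)^4. The coefficient t_4(m) of
   ψ(X)^4 counts, up to a factor 16, the representations of 8m + 4 as a sum of
   four odd squares. Since 8(7n+3) + 4 = 7(8n+4), left division by the eight
   quaternions 2 ± i ± j ± k of norm 7 gives t_4(7n+3) = t_4(n) mod 7. Hence
   the extracted series is -ψ(-X)^4 / ψ(-X) = -ψ(-X)^3, and the coefficients of
   (2ψ(X))^3 are the numbers r_3(8n+3), where 2^3 = 1 mod 7. All series are
   truncated to polynomials; the product formula for ψ comes from a finite
   identity of Shanks. *)
Require Import Defs.
From mathcomp Require Import all_boot all_order all_algebra.
From mathcomp Require Import ring zify.

Set Implicit Arguments.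
Unset Strict Implicit.
Unset Printing Implicit Defensive.

Import Order.TTheory GRing.Theory Num.Theory.
Local Open Scope ring_scope.

(** * Shanks' finite form of Gauss's identity *)

Section Shanks.
Variables (R : comNzRingType) (q : R).

(** With P_n the product over k < n of (1 - q^(2k+2)) / (1 - q^(2k+1)), this is Shanks' quotient P_n
    / P_s multiplied by the product of the 1 - q^(2k+1) with k < n. *)
Let D (n s : nat) : R :=
  (\prod_(k < s) (1 - q ^+ (2 * k + 1))) * \prod_(s <= k < n) (1 - q ^+ (2 * k + 2)).

Let D_recr n s : (s <= n)%N -> D n.+1 s = D n s * (1 - q ^+ (2 * n + 2)).
Proof. by move=> le_sn; rewrite /D big_nat_recr //= mulrA. Qed.

Let D_step n s : (s < n)%N ->
  D n s.+1 * (1 - q ^+ (2 * s + 2)) = D n s * (1 - q ^+ (2 * s + 1)).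
Proof.
move=> lt_sn; rewrite /D big_ord_recr /= [in RHS]big_ltn //.
set u := \prod_(i < s) _; set v := \big[_/_]_(_ <= _ < _) _; ring.
Qed.

(* Multiplying through by the odd product avoids all divisions; the induction
   step telescopes with g s = D n s (1 - q^(2s)) q^(s(2n+1)). *)
Lemma shanks_identity n :
  (\prod_(k < n) (1 - q ^+ (2 * k + 1))) * (\sum_(j < 2 * n) q ^+ 'C(j.+1, 2))
  = \sum_(s < n) (\prod_(k < s) (1 - q ^+ (2 * k + 1)))
      * (\prod_(s <= k < n) (1 - q ^+ (2 * k + 2))) * q ^+ (s * (2 * n + 1)).
Proof.
rewrite -[RHS]/(\sum_(s < n) D n s * q ^+ (s * (2 * n + 1))).
elim: n => [|n IHn]; first by rewrite muln0 !big_ord0 mulr0.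
pose g s := D n s * (1 - q ^+ (2 * s)) * q ^+ (s * (2 * n + 1)).
have tele : \sum_(s < n) (g s.+1 - g s) = g n.
  rewrite -(big_mkord xpredT (fun s => g s.+1 - g s)) telescope_sumr //.
  by rewrite /g muln0 expr0 subrr mulr0 mul0r subr0.
have stepE (s : 'I_n) : D n.+1 s * q ^+ (s * (2 * n.+1 + 1))
    = (1 - q ^+ (2 * n + 1)) * (D n s * q ^+ (s * (2 * n + 1)))
      + (g s.+1 - g s).
  rewrite /g D_recr 1?ltnW // (_ : 2 * s.+1 = 2 * s + 2)%N; last by lia.
  rewrite D_step // (_ : s * (2 * n.+1 + 1) = s * (2 * n + 1) + 2 * s)%N; last by lia.
  rewrite mulSn !exprD.
  by set u := q ^+ (2 * n); set v := q ^+ (2 * s); set w := q ^+ (s * _); ring.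
rewrite [RHS]big_ord_recr /= (eq_bigr _ (fun s _ => stepE s)) big_split /=.
rewrite -mulr_sumr -IHn tele.
(* The left side gains two terms, at the triangular numbers n(2n+1) and (n+1)(2n+1). *)
have -> : \sum_(j < 2 * n.+1) q ^+ 'C(j.+1, 2)
    = \sum_(j < (2 * n).+2) q ^+ 'C(j.+1, 2) by rewrite mulnS.
rewrite !big_ord_recr /=.
rewrite /g D_recr // /D big_geq // mulr1.
rewrite bin2 (_ : ((2 * n).+1 * (2 * n).+1.-1)./2 = n * (2 * n + 1))%N; last by lia.
rewrite bin2 (_ : ((2 * n).+2 * (2 * n).+2.-1)./2 = n * (2 * n + 1) + (2 * n + 1))%N; last by lia.
rewrite (_ : n * (2 * n.+1 + 1) = n * (2 * n + 1) + 2 * n)%N; last by lia.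
rewrite !exprD; set u := q ^+ (2 * n); set v := \prod_(k < n) _; set w := q ^+ (n * _).
set z := \sum_(j < _) _; ring.
Qed.
End Shanks.

(** * Partitions with distinct odd parts *)

Definition mult_bound (N i : nat) : nat := if odd i then 2 else N.

(* N only truncates the multiplicities of the even parts, so that every list
   is finite. *)
Fixpoint pods (N m : nat) : seq (seq nat) :=
  if m is m'.+1 then
    [seq nseq k m ++ s | k <- iota 0 (mult_bound N m), s <- pods N m']
  else [:: [::]].

(** A weakly decreasing list with entries at most m + 1 starts with all its copies of m + 1; their
    number and the remaining entries are the data from which [pods] rebuilds it. *)
Lemma podsP (N m : nat) (s : seq nat) : (0 < N)%N ->
  (s \in pods N m) = [&& sorted geq s, all (fun i => 0 < i <= m)%N s
    & all (fun i => count_mem i s < mult_bound N i)%N s].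
Proof.
move=> N_gt0; have geq_trans : transitive geq by move=> a b c ba ac; apply: leq_trans ac ba.
have bound_gt0 i : (0 < mult_bound N i)%N by rewrite /mult_bound; case: odd.
elim: m s => [|m IHm] s.
  by case: s => [|[|a] s] //=; rewrite ?andbF.
apply/allpairsP/idP => [[[k s']]|] /=.
  rewrite mem_iota IHm add0n => -[/= kb /and3P[s'_sort s'_le s'_mult] ->].
  have m1_s' : m.+1 \notin s'.
    by apply/negP => /(allP s'_le); rewrite ltnn andbF.
  have s'_lt i : i \in s' -> (i <= m)%N by move=> /(allP s'_le)/andP[].
  apply/and3P; split.
  - rewrite sorted_pairwise // pairwise_cat -!sorted_pairwise // s'_sort andbT.
    apply/andP; split.
      by apply/allrelP => x y /nseqP[-> _] /s'_lt; apply: leqW.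
    by elim: k {kb} => // -[|k] //= ->; rewrite leqnn.
  - rewrite all_cat all_nseq /= leqnn orbT /=.
    by apply: sub_all s'_le => i /andP[-> /leqW->].
  - apply/allP => i; rewrite mem_cat count_cat count_nseq => /orP[/nseqP[-> _]|is'].
      by rewrite /= eqxx mul1n (count_memPn m1_s') addn0.
    rewrite /= (_ : (m.+1 == i) = false) ?mul0n ?(allP s'_mult i is') //.
    by apply/negP => /eqP mi; move: m1_s'; rewrite mi is'.
move=> /and3P[s_sort s_le s_mult].
exists (count_mem m.+1 s, [seq i <- s | i != m.+1]); split => /=.
- rewrite mem_iota add0n /=; case: (boolP (m.+1 \in s)) => [/(allP s_mult)//|].
  by move=> /count_memPn->.
- rewrite IHm; apply/and3P; split.
  + exact: sorted_filter.
  + apply/allP => i; rewrite mem_filter => /andP[im /(allP s_le)/andP[-> /=]].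
    by rewrite leq_eqVlt (negbTE im).
  + apply/allP => i; rewrite mem_filter => /andP[_ /(allP s_mult)].
    by apply: leq_ltn_trans; rewrite count_filter; apply: sub_count => j /andP[].
apply: (@sorted_eq _ geq) => //.
- by move=> a b /andP[ba ab]; apply/anti_leq/andP.
- rewrite sorted_pairwise // pairwise_cat -!sorted_pairwise // sorted_filter // andbT.
  apply/andP; split.
    apply/allrelP => x y /nseqP[-> _]; rewrite mem_filter => /andP[_ /(allP s_le)].
    by case/andP.
  by elim: (count _ _) => // -[|k] //= ->; rewrite leqnn.
- rewrite -(perm_filterC (pred1 m.+1) s) -size_filter.
  by have /all_pred1P{1}<- := filter_all (pred1 m.+1) s.
Qed.

Lemma pods_uniq (N m : nat) : (0 < N)%N -> uniq (pods N m).
Proof.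
move=> N_gt0; elim: m => //= m IHm; apply: allpairs_uniq => //; first exact: iota_uniq.
have m1s s : s \in pods N m -> m.+1 \notin s.
  rewrite podsP // => /and3P[_ s_le _].
  by apply/negP => /(allP s_le); rewrite ltnn andbF.
move=> [k s] [k' s'] /allpairsP[[k1 s1] /= [_ /m1s s1m [-> ->]]].
move=> /allpairsP[[k2 s2] /= [_ /m1s s2m [-> ->]]] e.
have k12 : k1 = k2.
  have := congr1 (count_mem m.+1) e.
  by rewrite !count_cat !count_nseq /= eqxx !mul1n (count_memPn s1m) (count_memPn s2m) !addn0.
move: e; rewrite k12 => /(congr1 (drop k2)).
by rewrite !drop_size_cat ?size_nseq // => ->.
Qed.

(** Neither truncation is felt here: every entry is at most the sum, and so is the number of entries
    when all are positive. *)
Lemma mem_pods (N m : nat) (s : seq nat) : (sumn s < N <= m)%N ->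
  (s \in pods N m) = is_pod_partition s.
Proof.
move=> /andP[sN Nm]; rewrite podsP ?(leq_ltn_trans _ sN) //.
rewrite /is_pod_partition; congr (_ && _).
have le_sumn i : i \in s -> (i <= sumn s)%N.
  elim: s {sN} => //= a s IHs; rewrite inE => /orP[/eqP->|/IHs]; lia.
have lt_m i : i \in s -> (i <= m)%N.
  by move=> /le_sumn/leq_ltn_trans/(_ sN)/ltnW/leq_trans; apply.
have -> : all (fun i => 0 < i <= m)%N s = (0%N \notin s).
  apply/allP/idP => [s_le|s0 i si]; first by apply/negP => /s_le.
  by rewrite lt_m // andbT lt0n; apply: contraNneq s0 => <-.
case: (boolP (0%N \notin s)) => //= s0.
have size_s : (size s <= sumn s)%N.
  elim: s s0 {sN le_sumn lt_m} => //= a s IHs.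
  by rewrite inE negb_or => /andP[a0 /IHs]; lia.
apply/allP/idP => [s_mult|s_uniq i si].
  apply: count_mem_uniq => i; rewrite count_filter mem_filter.
  have [oi|ei] /= := boolP (odd i); last first.
    by apply/eqP; rewrite -leqn0 leqNgt -has_count; apply/hasPn => j _ /=;
       apply: contraNN ei => /andP[/eqP->].
  rewrite (eq_count (a2 := pred1 i)) => [|j /=]; last by case: eqP => //= ->.
  have [/[dup] si /s_mult|/count_memPn->//] := boolP (i \in s).
  have : (0 < count_mem i s)%N by rewrite -has_count has_pred1.
  rewrite /mult_bound oi; by case: (count_mem i s) => [|[]].
have [oi|ei] := boolP (odd i); rewrite /mult_bound ?oi ?(negbTE ei); last first.
  exact: leq_ltn_trans (count_size _ _) (leq_ltn_trans size_s sN).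
have := count_uniq_mem i s_uniq.
rewrite count_filter (eq_count (a2 := pred1 i)) => [->|j /=]; first by case: (_ \in _).
by case: eqP => //= ->.
Qed.

Definition pod_poly (R : nzRingType) (N m : nat) : {poly R} :=
  \sum_(s <- pods N m) 'X^(sumn s).

Lemma coef_pod_poly3 (R : comNzRingType) (N m n : nat) : (n < N <= m)%N ->
  (pod_poly R N m ^+ 3)`_n = (pod3 n)%:R.
Proof.
move=> /andP[nN Nm]; have N_gt0 := leq_ltn_trans (leq0n n) nN.
set E := pods N m.
pose T := [seq (ab, c) | ab <- [seq (a, b) | a <- E, b <- E], c <- E].
pose w (t : seq nat * seq nat * seq nat) := (sumn t.1.1 + sumn t.1.2 + sumn t.2)%N.
have T_uniq : uniq T.
  rewrite /T; apply: allpairs_uniq; rewrite ?pods_uniq //; 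
    last by move=> [a b] [a' b'] _ _ [-> ->].
  by apply: allpairs_uniq; rewrite ?pods_uniq // => -[a b] [a' b'] _ _ [-> ->].
rewrite (@pod3P n [seq t <- T | w t == n]) ?filter_uniq //; last first.
  move=> [[a b] c]; rewrite mem_filter /is_pod_triple /w /=.
  case: eqP => [wn|_]; rewrite ?andbF // andbT.
  have mE s : (sumn s <= n)%N -> is_pod_partition s = (s \in E).
    by move=> sn; rewrite mem_pods // (leq_ltn_trans sn nN) Nm.
  rewrite !mE; try lia.
  apply/allpairsP/idP => [[[ab c'] /= [/allpairsP[[a' b'] /= [aE bE ->]] cE [-> -> ->]]]|].
    by rewrite aE bE cE.
  move=> /and3P[aE bE cE]; exists ((a, b), c); split => //=.
  by apply/allpairsP; exists (a, b).
have -> : pod_poly R N m ^+ 3 = \sum_(t <- T) 'X^(w t).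
  rewrite /T big_allpairs big_allpairs exprSr expr2 /pod_poly !mulr_suml.
  apply: eq_bigr => a _; rewrite [X in X * _]mulr_sumr mulr_suml; apply: eq_bigr => b _.
  by rewrite mulr_sumr; apply: eq_bigr => c _; rewrite -!exprD.
rewrite coef_sum size_filter -sum1_count natr_sum [RHS]big_mkcond.
by apply: eq_bigr => t _; rewrite coefXn eq_sym; case: eqP.
Qed.

(** * Product formula for the generating function *)

Lemma pod_polyS (R : nzRingType) (N m : nat) :
  pod_poly R N m.+1
  = (\sum_(k < mult_bound N m.+1) 'X^(m.+1) ^+ k) * pod_poly R N m.
Proof.
rewrite [LHS]big_allpairs_dep mulr_suml -(big_mkord xpredT
  (fun k => 'X^(m.+1) ^+ k * pod_poly R N m)).
rewrite /index_iota subn0; apply: eq_bigr => k _.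
rewrite mulr_sumr; apply: eq_bigr => s _.
by rewrite sumn_cat sumn_nseq exprD exprM.
Qed.

(** An odd part contributes 1 + X^(2k+1). An even part contributes a truncated geometric sum, which
    1 - X^(2k+2) turns into 1 - X^(N(2k+2)); the last product is thus the truncation error, equal to
    1 modulo X^N. *)
Lemma pod_poly_prod (R : comNzRingType) (N n : nat) :
  pod_poly R N (2 * n) * \prod_(k < n) (1 - 'X^(2 * k + 2))
  = (\prod_(k < n) (1 + 'X^(2 * k + 1))) * \prod_(k < n) (1 - 'X^(N * (2 * k + 2))).
Proof.
elim: n => [|n IHn]; first by rewrite muln0 !big_ord0 /pod_poly /= big_seq1.
have -> : pod_poly R N (2 * n.+1) = pod_poly R N (2 * n).+2 by rewrite mulnS.
rewrite !pod_polyS !big_ord_recr /= /mult_bound /= oddM /=.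
rewrite !big_ord_recr big_ord0 /= expr0 expr1 add0r -(addn2 (2 * n)) -(addn1 (2 * n)).
have -> : 1 - 'X^(N * (2 * n + 2))
    = (\sum_(k < N) 'X^(2 * n + 2) ^+ k) * (1 - 'X^(2 * n + 2)) :> {poly R}.
  by rewrite (mulnC N) exprM -[LHS]opprB subrX1 -mulNr opprB mulrC.
set u := pod_poly _ _ _; set v := \prod_(k < n) (1 - 'X^(2 * k + 2)).
set g := \sum_(k < N) _; set x := 'X^(2 * n + 2); set y := 'X^(2 * n + 1).
transitivity (g * (1 - x) * (1 + y) * (u * v)); first by ring.
by rewrite IHn; ring.
Qed.

(* ψ(-X), truncated beyond degree N. *)
Definition psi_poly (R : nzRingType) (N : nat) : {poly R} :=
  \sum_(j < 2 * N) (- 'X) ^+ 'C(j.+1, 2).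

(** Let A be the even product and B the odd one. Modulo X^N, the product formula gives P A = B, and
    Shanks' identity at q = -X gives B ψ = A. Hence P ψ A = A, and A cancels because its constant
    term is 1. *)
Lemma pod_psi (F : fieldType) (N : nat) : (0 < N)%N ->
  'X^N %| pod_poly F N (2 * N) * psi_poly F N - 1.
Proof.
move=> N_gt0.
pose B : {poly F} := \prod_(k < N) (1 + 'X^(2 * k + 1)).
pose A : {poly F} := \prod_(k < N) (1 - 'X^(2 * k + 2)).
have E1 n : 'X^N %| (\prod_(k < n) (1 - 'X^(N * (2 * k + 2))) - 1 : {poly F}).
  elim: n => [|n IHn]; first by rewrite big_ord0 subrr dvdp0.
  rewrite big_ord_recr /=; set u := \prod_(i < n) _ in IHn *; set v := 'X^(_ * _).
  rewrite (_ : u * (1 - v) - 1 = (u - 1) - u * v); last by ring.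
  by rewrite dvdp_sub // dvdp_mull // /v dvdp_exp2l // leq_pmulr // addn2.
have A0 : coprimep ('X^N) A.
  rewrite coprimep_expl // coprimep_sym coprimepX rootE /A horner_prod.
  by apply/prodf_neq0 => k _; rewrite !hornerE expr0n addn2 subr0 oner_eq0.
have AE n m : \prod_(m <= k < n) (1 - 'X^(2 * k + 2))
    = \prod_(m <= k < n) (1 - (- 'X) ^+ (2 * k + 2)) :> {poly F}.
  by apply: eq_bigr => k _; rewrite exprNn -signr_odd oddD oddM /= mul1r.
have BPsi : 'X^N %| B * psi_poly F N - A.
  have -> : B = \prod_(k < N) (1 - (- 'X) ^+ (2 * k + 1)).
    by apply: eq_bigr => k _; rewrite exprNn -signr_odd oddD oddM /= mulN1r opprK.
  rewrite shanks_identity -[A](big_mkord xpredT (fun k => 1 - 'X^(2 * k + 2))) AE.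
  rewrite -(big_mkord xpredT (fun s =>
    (\prod_(k < s) (1 - (- 'X) ^+ (2 * k + 1)))
    * (\prod_(s <= k < N) (1 - (- 'X) ^+ (2 * k + 2))) * (- 'X) ^+ (s * (2 * N + 1)))).
  (* The term s = 0 is A itself; each other one is divisible by X^(s(2N+1)). *)
  rewrite big_ltn // big_ord0 mul1r mul0n mulr1 addrAC subrr add0r.
  rewrite big_seq; apply: (big_ind (fun p => 'X^N %| p)) => [|p r pN rN|s].
  - exact: dvdp0.
  - by rewrite dvdp_addr.
  rewrite mem_index_iota => /andP[s_gt0 _]; apply: dvdp_mull.
  rewrite exprNn; apply/dvdp_mull/dvdp_exp2l.
  by apply: leq_trans (leq_pmull _ s_gt0); lia.
rewrite -(Gauss_dvdpl _ A0).
have PA := pod_poly_prod F N N; rewrite -/A -/B in PA.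
set P := pod_poly _ _ _ in PA *; set Psi := psi_poly _ _ in BPsi *.
rewrite (_ : (P * Psi - 1) * A = Psi * (P * A) - A); last by ring.
rewrite PA; set E := \prod_(k < N) (1 - 'X^(N * _)).
rewrite (_ : Psi * (B * E) - A = (B * Psi) * (E - 1) + (B * Psi - A)); last by ring.
by rewrite dvdp_add // dvdp_mull // E1.
Qed.

Lemma dvdXnP (F : fieldType) (N : nat) (p : {poly F}) :
  reflect (forall i, (i < N)%N -> p`_i = 0) ('X^N %| p).
Proof.
apply: (iffP idP) => [/dvdpP[q ->] i iN|p0].
  by rewrite coefMXn iN.
rewrite -(poly_take_drop N p) (_ : take_poly N p = 0) ?add0r ?dvdp_mull //.
by apply/polyP => i; rewrite coef_take_poly coef0; case: ifP => // /p0.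
Qed.

(** * Extraction of an arithmetic progression *)

(** The seventh power is additive in characteristic 7, and (-X)^7 = -X^7 since 7 is odd. *)
Lemma psi_poly_frobenius (N : nat) :
  psi_poly 'F_7 N ^+ 7 = psi_poly 'F_7 N \Po 'X^7.
Proof.
have char7 : 7 \in [pchar {poly 'F_7}] by rewrite pchar_poly pchar_Fp.
rewrite -(pFrobenius_autE char7) /psi_poly !rmorph_sum; apply: eq_bigr => j _ /=.
rewrite pFrobenius_autE rmorphXn rmorphN /= comp_polyX exprAC.
by rewrite exprNn -signr_odd mulN1r.
Qed.

(** The bound [size p] loses nothing, because 7i + r is at least i. *)
Definition section7 (R : nzRingType) (r : nat) (p : {poly R}) : {poly R} :=
  \poly_(i < size p) p`_(7 * i + r).

Lemma coef_section7 (R : nzRingType) (r : nat) (p : {poly R}) i :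
  (section7 r p)`_i = p`_(7 * i + r).
Proof.
rewrite coef_poly; case: ltnP => // i_ge.
by rewrite nth_default // (leq_trans i_ge) //; lia.
Qed.

(** Induction on q in Horner form: extraction turns a factor X^7 into a factor X, and r < 7 makes
    the constant coefficient vanish on both sides. *)
Lemma section7_comp (R : comNzRingType) (r : nat) (p q : {poly R}) : (r < 7)%N ->
  section7 r (p * (q \Po 'X^7)) = section7 r p * q.
Proof.
move=> r7; elim/poly_ind: q => [|q c IHq].
  by rewrite comp_poly0 !mulr0; apply/polyP => i; rewrite coef_section7 !coef0.
rewrite comp_polyD comp_polyM comp_polyX comp_polyC !mulrDr (mulrA p) (mulrA (section7 r p)) -IHq.
apply/polyP => i; rewrite coef_section7 !coefD !coefMC coefMXn coefMX !coef_section7.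
case: i => [|i] /=; first by rewrite muln0 add0n r7.
have -> : (7 * i.+1 + r < 7)%N = false by lia.
by have -> : (7 * i.+1 + r - 7 = 7 * i + r)%N by lia.
Qed.

(** * Quaternions of norm 7 *)

Definition quat (R : Type) : Type := (R * R * R * R)%type.

Definition quat_norm (R : comNzRingType) (x : quat R) : R :=
  let: (a, b, c, d) := x in a ^+ 2 + b ^+ 2 + c ^+ 2 + d ^+ 2.

Definition quat_mul (R : comNzRingType) (x y : quat R) : quat R :=
  let: (a, b, c, d) := x in let: (a', b', c', d') := y in
  (a * a' - b * b' - c * c' - d * d', a * b' + b * a' + c * d' - d * c',
   a * c' - b * d' + c * a' + d * b', a * d' + b * c' - c * b' + d * a').

Definition quat_conj (R : comNzRingType) (x : quat R) : quat R :=
  let: (a, b, c, d) := x in (a, - b, - c, - d).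

Definition quat_all (R : Type) (P : pred R) (x : quat R) : bool :=
  let: (a, b, c, d) := x in [&& P a, P b, P c & P d].

Definition quat_map (R S : Type) (f : R -> S) (x : quat R) : quat S :=
  let: (a, b, c, d) := x in (f a, f b, f c, f d).

(* The eight quaternions 2 ± i ± j ± k represent the Lipschitz quaternions of
   norm 7 modulo right multiplication by units. *)
Definition quat7 (R : comNzRingType) (s : bool * bool * bool) : quat R :=
  (2%:R, (-1) ^+ s.1.1, (-1) ^+ s.1.2, (-1) ^+ s.2).

Definition sign_triples : seq (bool * bool * bool) :=
  [seq (ab, c) | ab <- [seq (a, b) | a <- [:: true; false], b <- [:: true; false]],
                 c <- [:: true; false]].

(** Quaternions over F_7 are 2 by 2 matrices, with the norm as determinant. The eight conjugates
    have rank 1, and their kernels are the eight lines of the plane. A nonzero singular x has a line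
    as image, killed by exactly one of them; x = 0 is killed by all eight. The proof checks the 7^4
    cases by computation. *)
Lemma quat7_count_F7 (x : quat 'F_7) : quat_norm x = 0 ->
  (count (fun s => quat_all (pred1 0%R) (quat_mul (quat_conj (quat7 _ s)) x))
     sign_triples %% 7 = 1)%N.
Proof.
pose F7 : seq 'F_7 := [:: 0; 1; 2; 3; 4; 5; 6].
have F7P (y : 'F_7) : y \in F7 by case: y; do 7! [case => //].
have chk : all (fun a => all (fun b => all (fun c => all (fun d : 'F_7 =>
  (quat_norm (a, b, c, d) == 0) ==>
   (count (fun s => quat_all (pred1 0%R) (quat_mul (quat_conj (quat7 _ s)) (a, b, c, d)))
     sign_triples %% 7 == 1)%N) F7) F7) F7) F7.
  by vm_cast_no_check (erefl true).
case: x => [[[a b] c] d] /eqP.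
move: chk => /allP/(_ a (F7P a))/allP/(_ b (F7P b))/allP/(_ c (F7P c)).
by move=> /allP/(_ d (F7P d))/implyP x0 /x0/eqP.
Qed.

Lemma quat_norm_map (R S : comNzRingType) (f : {rmorphism R -> S}) (x : quat R) :
  quat_norm (quat_map f x) = f (quat_norm x).
Proof. by case: x => [[[a b] c] d]; rewrite /= !rmorphD !rmorphXn. Qed.

Lemma quat7_conj_mul_map (R S : comNzRingType) (f : {rmorphism R -> S}) s
    (x : quat R) :
  quat_map f (quat_mul (quat_conj (quat7 R s)) x)
  = quat_mul (quat_conj (quat7 S s)) (quat_map f x).
Proof.
case: x => [[[a b] c] d].
by rewrite /= !(rmorphD, rmorphB, rmorphM, rmorphN, rmorph_sign, rmorph_nat).
Qed.

Definition quat_dvd7 : pred (quat int) := quat_all (fun a => (7 %| a)%Z).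

Lemma quat7_count (x : quat int) : (7 %| quat_norm x)%Z ->
  (count (fun s => quat_dvd7 (quat_mul (quat_conj (quat7 _ s)) x))
     sign_triples %% 7 = 1)%N.
Proof.
have dvd7E a : (7 %| a)%Z = (a%:~R == 0 :> 'F_7).
  by rewrite (@dvdz_pcharf 'F_7 7) ?pchar_Fp.
rewrite dvd7E -(quat_norm_map intr) => /eqP/quat7_count_F7.
congr ((_ %% 7)%N = 1%N); apply: eq_count => s.
rewrite -quat7_conj_mul_map; case: (quat_mul _ _) => [[[a b] c] d] /=.
by rewrite !dvd7E.
Qed.

(** Each coordinate of the product combines one even term, coming from the coordinate 2, with three
    odd ones. *)
Lemma quat_odd_mul7 s (x : quat int) :
  quat_all (fun a => odd `|a|) x ->
  quat_all (fun a => odd `|a|) (quat_mul (quat7 _ s) x).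
Proof.
case: s => [[e1 e2] e3]; case: x => [[[a b] c] d] /= /and4P[].
by case: e1; case: e2; case: e3; rewrite ?expr1 ?expr0 => *;
  apply/and4P; split; lia.
Qed.

Lemma quat_odd_mul7_conj s (x y : quat int) :
  quat_mul (quat_conj (quat7 _ s)) x = quat_map ( *%R 7) y ->
  quat_all (fun a => odd `|a|) x -> quat_all (fun a => odd `|a|) y.
Proof.
case: s => [[e1 e2] e3]; case: x => [[[a b] c] d]; case: y => [[[a' b'] c'] d'] /=.
move=> [] E1 E2 E3 E4 /and4P[].
by move: E1 E2 E3 E4; case: e1; case: e2; case: e3; rewrite ?expr1 ?expr0 => *;
  apply/and4P; split; lia.
Qed.

Lemma quat_mul7I : injective (quat_map ( *%R (7 : int))).
Proof.
move=> [[[a b] c] d] [[[a' b'] c'] d'] [] /= *.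
by congr (_, _, _, _); lia.
Qed.

Lemma quat_dvd7P (x : quat int) :
  reflect (exists y, x = quat_map ( *%R 7) y) (quat_dvd7 x).
Proof.
apply: (iffP idP) => [|[[[[a b] c] d] ->]]; last by rewrite /= !dvdz_mulr.
case: x => [[[a b] c] d] /and4P[/dvdzP[a' ->] /dvdzP[b' ->] /dvdzP[c' ->] /dvdzP[d' ->]].
by exists (a', b', c', d') => /=; congr (_, _, _, _); rewrite mulrC.
Qed.

Section Quat7.
Variable (s : bool * bool * bool).

Lemma quat7_mulK (x : quat int) :
  quat_mul (quat_conj (quat7 _ s)) (quat_mul (quat7 _ s) x) = quat_map ( *%R 7) x.
Proof.
case: s x => [[e1 e2] e3] [[[a b] c] d] /=.
by case: e1; case: e2; case: e3; rewrite ?expr1 ?expr0; congr (_, _, _, _); ring.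
Qed.

Lemma quat7_conj_mulK (x : quat int) :
  quat_mul (quat7 _ s) (quat_mul (quat_conj (quat7 _ s)) x) = quat_map ( *%R 7) x.
Proof.
case: s x => [[e1 e2] e3] [[[a b] c] d] /=.
by case: e1; case: e2; case: e3; rewrite ?expr1 ?expr0; congr (_, _, _, _); ring.
Qed.

Lemma quat_norm_mul7 (x : quat int) :
  quat_norm (quat_mul (quat7 _ s) x) = 7 * quat_norm x.
Proof.
case: s x => [[e1 e2] e3] [[[a b] c] d] /=.
by case: e1; case: e2; case: e3; rewrite ?expr1 ?expr0; ring.
Qed.

Lemma quat_mulZ7 (x : quat int) :
  quat_mul (quat7 _ s) (quat_map ( *%R 7) x)
  = quat_map ( *%R 7) (quat_mul (quat7 _ s) x).
Proof. by case: x => [[[a b] c] d] /=; congr (_, _, _, _); ring. Qed.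

(** Put α = [quat7 _ s]. As α times its conjugate is 7, the counted condition says that α divides x
    on the left, and y ↦ αy is a bijection from L onto the x in L' with this property. *)
Lemma quat7_count_odd_norm (m : int) (L L' : seq (quat int)) :
  uniq L -> uniq L' ->
  (forall x, (x \in L) = quat_all (fun a => odd `|a|) x && (quat_norm x == m)) ->
  (forall x, (x \in L') = quat_all (fun a => odd `|a|) x && (quat_norm x == 7 * m)) ->
  count (fun x => quat_dvd7 (quat_mul (quat_conj (quat7 _ s)) x)) L' = size L.
Proof.
move=> uL uL' LP L'P; rewrite -size_filter -(size_map (quat_mul (quat7 _ s)) L).
apply/perm_size/uniq_perm; rewrite ?filter_uniq //.
  rewrite map_inj_uniq // => x y /(congr1 (quat_mul (quat_conj (quat7 _ s)))).
  by rewrite !quat7_mulK => /quat_mul7I.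
move=> x; rewrite mem_filter L'P; apply/and3P/mapP => [[/quat_dvd7P[y xy] ox /eqP nx]|[y]].
  have xE : x = quat_mul (quat7 _ s) y.
    by apply: quat_mul7I; rewrite -quat7_conj_mulK xy quat_mulZ7.
  exists y => //; rewrite LP (quat_odd_mul7_conj xy ox) /=; apply/eqP.
  by move: nx; rewrite xE quat_norm_mul7 => /mulfI; apply.
rewrite LP => /andP[oy /eqP ny] ->; split.
- by apply/quat_dvd7P; exists y; rewrite quat7_mulK.
- exact: quat_odd_mul7.
- by rewrite quat_norm_mul7 ny.
Qed.
End Quat7.

(* Count the pairs (s, x) with x in L' and quat7 s a left divisor of x: there
   are 8 |L| of them, and each x has either one or all eight divisors. *)
Lemma odd_four_squares_mod7 (m : int) (L L' : seq (quat int)) :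
  uniq L -> uniq L' ->
  (forall x, (x \in L) = quat_all (fun a => odd `|a|) x && (quat_norm x == m)) ->
  (forall x, (x \in L') = quat_all (fun a => odd `|a|) x && (quat_norm x == 7 * m)) ->
  size L' = size L %[mod 7].
Proof.
move=> uL uL' LP L'P.
have exch : (\sum_(s <- sign_triples) \sum_(x <- L')
      nat_of_bool (quat_dvd7 (quat_mul (quat_conj (quat7 _ s)) x))
    = \sum_(x <- L') \sum_(s <- sign_triples)
      nat_of_bool (quat_dvd7 (quat_mul (quat_conj (quat7 _ s)) x)))%N.
  exact: exchange_big.
have sum_count T (P : pred T) r : (\sum_(i <- r) nat_of_bool (P i))%N = count P r.
  by rewrite -sum1_count [RHS]big_mkcond; apply: eq_bigr => i _; case: (P i).
rewrite (eq_bigr (fun=> size L)) in exch; last first.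
  by move=> s _; rewrite sum_count (quat7_count_odd_norm s uL uL' LP L'P).
have L'1 : (\sum_(x <- L') count (fun s => quat_dvd7 (quat_mul (quat_conj (quat7 _ s)) x))
    sign_triples = size L' %[mod 7])%N.
  rewrite -(sum1_size L') -modn_summ.
  congr (_ %% _)%N; apply: eq_big_seq => x; rewrite L'P => /andP[_ /eqP nx].
  by rewrite quat7_count // nx dvdz_mulr.
rewrite -L'1 -(eq_bigr _ (fun x _ => sum_count _ _ _)) -exch.
by rewrite big_const_seq count_predT iter_addn_0 -[size sign_triples]/8%N; lia.
Qed.

(** * Sums of odd squares *)

(** A sign and an index a encode each odd integer exactly once, and its square is 8 times the a-th
    triangular number plus 1. *)
Definition oddz (x : bool * nat) : int := (-1) ^+ x.1 * (2 * x.2%:Z + 1).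

Lemma oddz_inj : injective oddz.
Proof.
move=> [e a] [e' a']; rewrite /oddz /=.
by case: e; case: e'; rewrite ?expr1 ?expr0 => h; congr (_, _); lia.
Qed.

Lemma oddz_sqr x : oddz x ^+ 2 = 8 * 'C(x.2.+1, 2)%:Z + 1.
Proof.
case: x => e a; rewrite /oddz exprMn sqrr_sign mul1r /=.
have := mul_bin_diag a.+1 1; rewrite bin1 /= => h.
have hc : 2 * 'C(a.+1, 2)%:Z = (a%:Z + 1) * a%:Z by rewrite -PoszM -h; lia.
rewrite (_ : 8 * 'C(a.+1, 2)%:Z = 4 * (2 * 'C(a.+1, 2)%:Z)); last by ring.
by rewrite hc; ring.
Qed.

Lemma oddzP (z : int) : odd `|z| -> exists x, oddz x = z.
Proof.
move=> oz; exists (z < 0, (`|z|%N)./2); rewrite /oddz /=.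
by case: (ltrP z 0) => z0; rewrite ?expr1 ?expr0; lia.
Qed.

Lemma odd_oddz x : odd `|oddz x|.
Proof. by case: x => [[] a]; rewrite /oddz /= ?expr1 ?expr0; lia. Qed.

(** These encode the representations of 8n + k by k odd squares. For n < N the bound on the indices
    omits none, since a is at most its triangular number. *)
Definition odd_reps (k N n : nat) : {set {ffun 'I_k -> bool * 'I_N}} :=
  [set f : {ffun 'I_k -> bool * 'I_N} | \sum_i 'C((f i).2.+1, 2) == n]%N.

Definition oddz_ffun (k N : nat) (f : {ffun 'I_k -> bool * 'I_N}) :
    {ffun 'I_k -> int} :=
  [ffun i => oddz ((f i).1, val (f i).2)].

Lemma oddz_ffun_inj k N : injective (@oddz_ffun k N).
Proof.
move=> f g /ffunP fg; apply/ffunP => i; move: (fg i); rewrite !ffunE => /oddz_inj.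
by case: (f i) (g i) => [e a] [e' a'] [-> /val_inj->].
Qed.

Lemma mem_odd_reps k N n (x : {ffun 'I_k -> int}) : (n < N)%N ->
  (x \in [seq oddz_ffun f | f <- enum (odd_reps k N n)])
  = [forall i, odd `|x i|] && (\sum_i x i ^+ 2 == (8 * n + k)%N%:Z).
Proof.
move=> nN.
have sqrE (y : 'I_k -> bool * nat) : \sum_i oddz (y i) ^+ 2
    = (8 * (\sum_i 'C((y i).2.+1, 2)) + k)%N%:Z.
  rewrite (eq_bigr _ (fun i _ => oddz_sqr (y i))).
  rewrite big_split /= sumr_const card_ord -mulr_sumr PoszD PoszM.
  by congr (_ * _ + _); rewrite ?natz // (big_morph Posz PoszD (erefl 0)).
apply/mapP/andP => [[f]|[/forallP x_odd /eqP xn]].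
  rewrite mem_enum inE => /eqP fn ->; split.
    by apply/forallP => i; rewrite ffunE odd_oddz.
  rewrite (eq_bigr (fun i : 'I_k => oddz ((fun j => ((f j).1, val (f j).2)) i) ^+ 2)) => [|i _].
    by rewrite sqrE /= fn.
  by rewrite ffunE.
have [y yE] := fin_all_exists (fun i => oddzP (x_odd i)).
have yn : (\sum_i 'C((y i).2.+1, 2) = n)%N.
  move: xn; rewrite -(eq_bigr _ (fun i _ => congr1 (fun z => z ^+ 2) (yE i))) sqrE.
  by lia.
have y_lt i : ((y i).2 < N)%N.
  apply: leq_ltn_trans nN; rewrite -yn (bigD1 i) //=.
  by apply: leq_trans (leq_addr _ _); rewrite binS bin1 leq_addl.
exists [ffun i => ((y i).1, Ordinal (y_lt i))].
  by rewrite mem_enum inE -[eqbRHS]yn; apply/eqP/eq_bigr => i _; rewrite ffunE.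
by apply/ffunP => i; rewrite !ffunE /= -yE; case: (y i).
Qed.

(** Squares are 1 modulo 8 or 0 modulo 4, so three of them can add up to 8n + 3 only if all are
    odd. *)
Lemma nb_sum_three_squares (N n : nat) : (n < N)%N ->
  nb_sum_squares 3 (8 * n + 3) = #|odd_reps 3 N n|.
Proof.
move=> nN; rewrite (@nb_sum_squaresP _ _ [seq oddz_ffun f | f <- enum (odd_reps 3 N n)]).
- by rewrite size_map -cardE.
- by rewrite map_inj_uniq ?enum_uniq //; apply: oddz_ffun_inj.
move=> x; rewrite mem_odd_reps //; case: eqP => [xn|_]; rewrite ?andbT ?andbF //.
apply/forallP; move: xn; rewrite !big_ord_recl big_ord0 addr0 => xn.
have sqr8 (z : int) : exists k : int, z ^+ 2 = if odd `|z| then 8 * k + 1 else 4 * k.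
  have [/oddzP[w <-]|ez] := boolP (odd `|z|); first by exists ('C(w.2.+1, 2)%:Z); rewrite oddz_sqr.
  have [w ->] : exists w : int, z = 2 * w by exists (z %/ 2)%Z; lia.
  by exists (w ^+ 2); ring.
have xi : forall i : 'I_3, [|| i == ord0, i == lift ord0 ord0 | i == lift ord0 (lift ord0 ord0)].
  by move=> [[|[|[|j]]] p].
move=> i; move: xn (xi i).
have [a ->] := sqr8 (x ord0); have [b ->] := sqr8 (x (lift ord0 ord0)).
have [c ->] := sqr8 (x (lift ord0 (lift ord0 ord0))).
by do 3! case: ifP => ?; move=> xn /or3P[] /eqP-> //; lia.
Qed.

Lemma card_odd_four_reps_mod7 (N n : nat) : (7 * n + 3 < N)%N ->
  #|odd_reps 4 N (7 * n + 3)| = #|odd_reps 4 N n| %[mod 7].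
Proof.
move=> nN; pose o j : 'I_4 := inord j.
pose q (x : {ffun 'I_4 -> int}) : quat int := (x (o 0%N), x (o 1%N), x (o 2), x (o 3)).
pose L m := [seq q (oddz_ffun f) | f <- enum (odd_reps 4 N m)].
have oP (i : 'I_4) : [\/ i = o 0%N, i = o 1%N, i = o 2 | i = o 3].
  by case: i => [[|[|[|[|]]]]] // p; [constructor 1|constructor 2|constructor 3|constructor 4];
     apply/val_inj; rewrite /= inordK.
have q_inj : injective q.
  by move=> x y [x0 x1 x2 x3]; apply/ffunP => i; case: (oP i) => ->.
have L_uniq m : uniq (L m).
  by rewrite map_inj_uniq ?enum_uniq // => f g /q_inj/oddz_ffun_inj.
have sizeL m : size (L m) = #|odd_reps 4 N m| by rewrite size_map -cardE.
have LP m z : (m < N)%N -> (z \in L m) = quat_all (fun a => odd `|a|) z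
    && (quat_norm z == (8 * m + 4)%N%:Z).
  move=> mN; case: z => [[[a b] c] d].
  pose x := [ffun i : 'I_4 => [:: a; b; c; d]`_i].
  have -> : (a, b, c, d) = q x by rewrite /q !ffunE !inordK.
  rewrite /L (map_comp q (@oddz_ffun 4 N)) mem_map // mem_odd_reps //.
  have -> : [forall i, odd `|x i|] = quat_all (fun a => odd `|a|) (q x).
    apply/forallP/and4P => [x_odd|[x0 x1 x2 x3] i]; first by split.
    by case: (oP i) => ->.
  suff -> : \sum_i x i ^+ 2 = quat_norm (q x) by [].
  rewrite (eq_bigr (fun i : 'I_4 => x (o i) ^+ 2)) => [|i _]; last first.
    by congr (_ ^+ 2); congr (fun_of_fin x _); apply: val_inj; rewrite /= inordK.
  by rewrite !big_ord_recl big_ord0 addr0 !addrA.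
rewrite -!sizeL; apply: (@odd_four_squares_mod7 (8 * n + 4)%N%:Z) => // z.
  by rewrite LP //; lia.
rewrite LP // (_ : Posz (8 * (7 * n + 3) + 4) = 7 * (8 * n + 4)%N%:Z) //; lia.
Qed.

(** Doubling accounts for the two signs of an odd integer, so the expanded power is a sum over all
    functions into [bool * 'I_(2 * N)]; the sign comes from (-X)^n. *)
Lemma coef_psi_exp (R : comNzRingType) (k N n : nat) :
  ((psi_poly R N *+ 2) ^+ k)`_n = (-1) ^+ n * #|odd_reps k (2 * N) n|%:R.
Proof.
have -> : psi_poly R N *+ 2
    = \sum_(y : bool * 'I_(2 * N)) (- 'X) ^+ 'C(y.2.+1, 2).
  rewrite -(pair_bigA _ (fun _ (j : 'I__) => (- 'X) ^+ 'C(j.+1, 2))) /=.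
  by rewrite big_const card_bool /= addr0.
rewrite -[k in LHS](card_ord k) -prodr_const bigA_distr_bigA coef_sum.
rewrite -sum1_card natr_sum mulr_sumr [RHS]big_mkcond; apply: eq_bigr => f _.
rewrite prodrXr inE; set c := (\sum_(i < k) _)%N.
rewrite [(- 'X) ^+ c]exprNn -polyC1 -polyCN -rmorphXn /= mul_polyC coefZ coefXn eq_sym.
by case: eqP => [->|_]; rewrite ?mulr1 ?mulr0.
Qed.

Lemma coef_psi4_7n3 (N n : nat) : (7 * n + 3 < 2 * N)%N ->
  (psi_poly 'F_7 N ^+ 4)`_(7 * n + 3) = - (psi_poly 'F_7 N ^+ 4)`_n.
Proof.
move=> nN; have char7 : 7 \in [pchar 'F_7] by rewrite pchar_Fp.
have coefE i : (psi_poly 'F_7 N ^+ 4)`_i * 16%:R = (-1) ^+ i * #|odd_reps 4 (2 * N) i|%:R.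
  by rewrite -coef_psi_exp exprMn_n coefMn mulr_natr.
have nz16 : 16%:R != 0 :> 'F_7 by [].
apply: (mulIf nz16); rewrite mulNr !coefE -(GRing.natr_mod_pchar char7).
rewrite card_odd_four_reps_mod7 // (GRing.natr_mod_pchar char7) -mulNr.
(* The minus sign arises because 7n + 3 and n have opposite parity. *)
congr (_ * _); rewrite -signr_odd -[(-1) ^+ n]signr_odd oddD oddM addbT /=.
by case: (odd n); rewrite ?opprK.
Qed.

(** * Extraction of the exponents 7n + 3 and conclusion *)

Theorem theorem4p1 (n : nat) :
  ((pod3 (7 * n + 3)%N)%:Z
     = (-1) ^+ n.+1 * (nb_sum_squares 3 (8 * n + 3)%N)%:Z %[mod 7])%Z.
Proof.
(* Precision X^N before extraction becomes precision X^M after it, which just includes the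
   coefficient of index n. *)
set M := n.+1; set N := (7 * M)%N.
pose P := pod_poly 'F_7 N (2 * N); pose Psi := psi_poly 'F_7 N.
have N_gt0 : (0 < N)%N by [].
have PPsi : 'X^N %| P * Psi - 1 by apply: pod_psi.
pose S := section7 3 (P ^+ 3).
have sec_cong : 'X^M %| S * Psi + Psi ^+ 4.
  have /dvdpP[a aE] : 'X^N %| P ^+ 3 * (Psi \Po 'X^7) - Psi ^+ 4.
    rewrite -psi_poly_frobenius -/Psi.
    (* This is P^3 ψ^7 - ψ^4 = ψ^4 ((Pψ)^3 - 1), with the difference of cubes factored. *)
    rewrite (_ : _ - _ = (P * Psi - 1) * (Psi ^+ 4 * ((P * Psi) ^+ 2 + P * Psi + 1)));
      last by ring.
    exact: dvdp_mulr.
  apply/dvdXnP => i iM.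
  (* The error a X^N is a times X^M evaluated at X^7, so its extraction is a multiple of X^M. *)
  have : (section7 3 (a * ('X^M \Po 'X^7)))`_i = 0.
    by rewrite section7_comp // coefMXn iM.
  rewrite coef_section7 comp_Xn_poly -exprM -aE coefB -!coef_section7 section7_comp //.
  rewrite coef_section7 coef_psi4_7n3; first by rewrite opprK coefD.
  by rewrite /N /M; lia.
have S_cong : 'X^M %| S + Psi ^+ 3.
  have PPsiM : 'X^M %| P * Psi - 1.
    by apply: dvdp_trans PPsi; rewrite dvdp_exp2l // leq_pmull.
  (* Multiplying by P, the inverse of ψ modulo X^M, cancels one factor ψ. *)
  rewrite (_ : _ + _ = P * (S * Psi + Psi ^+ 4) - (P * Psi - 1) * (S + Psi ^+ 3));
    last by ring.
  by apply: dvdp_sub; [apply: dvdp_mull|apply: dvdp_mulr].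
have := dvdXnP _ _ S_cong n (ltnSn n).
rewrite coefD coef_section7 coef_pod_poly3; last by rewrite /N /M; lia.
have -> : (Psi ^+ 3)`_n = (-1) ^+ n * (nb_sum_squares 3 (8 * n + 3))%:R.
  rewrite (@nb_sum_three_squares (2 * N)); last by rewrite /N /M; lia.
  (* The factor 2^3 from the signs is 7 + 1, hence 1 in F_7. *)
  by rewrite -coef_psi_exp exprMn_n coefMn mulrSr -mulr_natr pchar_Zp // mulr0 add0r.
move=> pod0; apply/eqP; rewrite eqz_mod_dvd (@dvdz_pcharf 'F_7 7) ?pchar_Fp //.
rewrite rmorphB rmorphM rmorph_sign /= exprS mulN1r mulNr opprK.
by apply/eqP.
Qed.
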